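(* Let $X$ be a Banach space, $T$ a bounded linear operator on $X$, and $0<p<\infty$. The following assertions are equivalent: (1) $T$ is not $p$-absolutely Cesàro bounded. (2) There exists a vector $x\in X$ such that $\displaystyle\sup_{N\in\mathbb N_0}\frac1{N+1}\sum_{j=0}^N\|T^jx\|^p=\infty$. (3) The set of all vectors $x\in X$ such that $\displaystyle\sup_{N\in\mathbb N_0}\frac1{N+1}\sum_{j=0}^N\|T^jx\|^p=\infty$ is residual in $X$.
   Context: $\mathbb N_0=\{0,1,2,\dots\}$. A bounded linear operator $T$ on $X$ is $p$-absolutely Cesàro bounded if there is $C>0$ with $\sup_{n\ge1}\frac1n\sum_{k=0}^{n-1}\|T^kx\|^p\le C\|x\|^p$ for all $x\in X$. A subset of $X$ is residual if it contains a dense $G_\delta$-subset of $X$ (equivalently, its complement is meager). *)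

(* Defs.v *)
From HB Require Import structures.
From mathcomp Require Import all_boot all_order all_algebra.
From mathcomp Require Import all_classical all_reals all_analysis.
From mathcomp Require Import borel_hierarchy complex.

Set Implicit Arguments.
Unset Strict Implicit.
Unset Printing Implicit Defensive.

Import Order.TTheory GRing.Theory Num.Theory.
Import numFieldNormedType.Exports.

Local Open Scope classical_set_scope.
Local Open Scope ring_scope.

(* A Banach space is taken over the real or over the complex numbers. *)
Inductive scalars := RealScalars | ComplexScalars.

Definition scalar_field (R : realType) (s : scalars) : numFieldType :=
  match s with
  | RealScalars => R
  | ComplexScalars => R[i]
  end.

(* In a normedModType K the norm takes its values in K; for K = R[i] these
   values are nonnegative reals embedded in R[i], so [complex.Re] only undoes
   the embedding R -> R[i]. *)
Definition to_real (R : realType) (s : scalars) : scalar_field R s -> R :=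
  match s with
  | RealScalars => fun a => a
  | ComplexScalars => fun a => complex.Re a
  end.

Section CesaroBounded.
Context {R : realType} {s : scalars} {X : normedModType (scalar_field R s)}.
Implicit Types (T : {linear X -> X}) (p : R) (x : X).

Definition rnorm x : R := to_real `|x|.

Definition bounded_operator T := exists M : R, forall x, rnorm (T x) <= M * rnorm x.

Definition cesaro_mean p T x (n : nat) : R :=
  n%:R^-1 * \sum_(0 <= k < n) rnorm (iter k T x) `^ p.

Definition abs_cesaro_bounded p T :=
  exists2 C : R, 0 < C & forall x : X,
    (ereal_sup [set (cesaro_mean p T x n)%:E | n in [set n : nat | (1 <= n)%N]]
      <= (C * rnorm x `^ p)%:E)%E.

(* sup_{N >= 0} (N+1)^-1 * \sum_(j = 0)^N ||T^j x||^p *)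
Definition sup_cesaro_mean p T x : \bar R :=
  ereal_sup (range (fun N : nat => (cesaro_mean p T x N.+1)%:E)).

End CesaroBounded.

Definition residual (X : topologicalType) (A : set X) :=
  exists G : set X, [/\ Gdelta G, dense G & G `<=` A].

(* Main.v *)
(** The functional x |-> sup_N mean_N(x) is a supremum of continuous functions,
    so the set where it is infinite is a G_delta.  Since
    mean_N(x - y) <= 2^p (mean_N(x) + mean_N(y)), one point x0 of this set
    makes it dense: y and y + t x0 cannot both lie outside it.  If the set is
    empty, Baire's theorem gives a ball on which all the means are bounded by
    one constant; the same inequality moves the ball to the origin, and
    homogeneity of degree p yields absolute Cesaro boundedness. *)

Require Import Defs.
From HB Require Import structures.
From mathcomp Require Import all_boot all_order all_algebra.
From mathcomp Require Import all_classical all_reals all_analysis.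
From mathcomp Require Import complex lra.

Set Implicit Arguments.
Unset Strict Implicit.
Unset Printing Implicit Defensive.

Import Order.TTheory GRing.Theory Num.Theory.
Import numFieldNormedType.Exports.

Local Open Scope classical_set_scope.
Local Open Scope ring_scope.

(** * Baire's theorem in complete pseudometric spaces *)

(* The Baire theorem of the library is restricted to normed modules over a
   realType.  The sequence e stands in for the archimedean property, which a
   numFieldType such as R[i] does not provide. *)
Lemma Baire_pseudometric (K : numFieldType) (U : completePseudoMetricType K)
    (F : (set U)^nat) (e : nat -> K) :
  (forall n, 0 < e n) -> (forall d, 0 < d -> exists n, e n <= d) ->
  (forall i, open (F i)) -> (forall i, dense (F i)) ->
  dense (\bigcap_i F i).
Proof.
move=> e0 e_small oF dF D [x Dx] oD.
(* The doubled radius does the work of a closed ball: it keeps the limit of the centres inside the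
   previous ball. *)
have step n (a : U * {posnum K}) : exists b : U * {posnum K},
    b.2%:num <= e n /\
    ball b.1 (b.2%:num + b.2%:num) `<=` ball a.1 a.2%:num `&` F n.
  have [|y [ay Fy]] := dF n (interior (ball a.1 a.2%:num)) _ (open_interior _).
    by exists a.1; exact: nbhsx_ballx.
  have /nbhs_ballP[d d0 db] : nbhs y (ball a.1 a.2%:num `&` F n).
    by apply: filterI; [exact: ay | exact: open_nbhs_nbhs].
  have d20 : 0 < d / 2 by exact: divr_gt0.
  have [r [r0 rd re]] : exists r, [/\ 0 < r, r <= d / 2 & r <= e n].
    (* Positive elements of a [numFieldType] are real, so the two bounds are comparable. *)
    have [h|h] := real_leP (gtr0_real d20) (gtr0_real (e0 n)).
    - by exists (d / 2).
    - by exists (e n); split => //; exact: ltW.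
  exists (y, PosNum r0); split => //=; apply: subset_trans db.
  by apply: le_ball; rewrite (le_trans (lerD rd rd))// -splitr.
have /choice[g gP] : forall na : nat * (U * {posnum K}),
    exists b : U * {posnum K}, b.2%:num <= e na.1 /\
    ball b.1 (b.2%:num + b.2%:num) `<=` ball na.2.1 na.2.2%:num `&` F na.1.
  by move=> [n a]; exact: step.
have /nbhs_ballP[r r0 rD] : nbhs x D by exact: open_nbhs_nbhs.
pose u := fix u n : U * {posnum K} :=
  if n is m.+1 then g (m, u m) else (x, PosNum r0).
have uE n : (u n.+1).2%:num <= e n /\
    ball (u n.+1).1 ((u n.+1).2%:num + (u n.+1).2%:num) `<=`
    ball (u n).1 (u n).2%:num `&` F n by exact: (gP (n, u n)).
have ball_sub n : ball (u n.+1).1 (u n.+1).2%:num `<=` ball (u n).1 (u n).2%:num.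
  move=> z uz; have [|//] := (uE n).2 z.
  by apply: le_ball uz; rewrite lerDl.
have ball_mono n m : (n <= m)%N ->
    ball (u m).1 (u m).2%:num `<=` ball (u n).1 (u n).2%:num.
  move=> /subnK <-; elim: (m - n)%N => [//|k IH].
  exact: subset_trans (ball_sub _) IH.
have uball n m : (n <= m)%N -> ball (u n).1 (u n).2%:num (u m).1.
  by move=> /ball_mono; apply; exact: ballxx.
have /cauchy_cvg ucvg : cauchy ((fun n => (u n).1) @ \oo).
  apply: cauchy_exP => d d0; have [n nd] := e_small d d0.
  exists (u n.+1).1; exists n.+1 => // m /= /uball; apply: le_ball.
  exact: le_trans (uE n).1 nd.
set l := lim ((fun n => (u n).1) @ \oo) in ucvg.
(* A late centre lies in ball [n.+1] and within its radius of [l], so [l] lies in the doubled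
   ball. *)
have ul n : (ball (u n).1 (u n).2%:num `&` F n) l.
  apply: (uE n).2.
  have /ucvg[m _ /(_ (maxn m n.+1) (leq_maxl _ _)) /= hl] :
    nbhs l (ball l (u n.+1).2%:num) by exact: nbhsx_ballx.
  exact: ball_triangle (uball _ _ (leq_maxr m n.+1)) (ball_sym hl).
by exists l; split=> [|i _]; [exact/rD/(ul 0%N).1 | exact: (ul i).2].
Qed.

(** * Real numbers inside the scalar field *)

Definition of_real (R : realType) (s : scalars) : R -> scalar_field R s :=
  match s with
  | RealScalars => fun a => a
  | ComplexScalars => real_complex R
  end.
Arguments of_real {R s}.

Section ScalarField.
Context {R : realType} {s : scalars}.
Implicit Types (a b : R) (z : scalar_field R s).

Lemma of_realK : cancel of_real (@to_real R s).
Proof. by case: s. Qed.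

Lemma of_real_le a b : (of_real a <= of_real b :> scalar_field R s) = (a <= b).
Proof. by case: s => //=; rewrite lecR. Qed.

Lemma of_real_lt a b : (of_real a < of_real b :> scalar_field R s) = (a < b).
Proof. by case: s => //=; rewrite ltcR. Qed.

Lemma of_real0 : of_real 0 = 0 :> scalar_field R s.
Proof. by case: s. Qed.

Lemma of_realD a b : of_real (a + b) = of_real a + of_real b :> scalar_field R s.
Proof. by case: s => //=; rewrite rmorphD. Qed.

Lemma of_realM a b : of_real (a * b) = of_real a * of_real b :> scalar_field R s.
Proof. by case: s => //=; rewrite rmorphM. Qed.

Lemma to_realK z : 0 <= z -> of_real (to_real z) = z.
Proof. by case: s z => //= z z0; rewrite RRe_real// ger0_real. Qed.

Lemma norm_of_real a : 0 <= a -> `|of_real a : scalar_field R s| = of_real a.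
Proof. by move=> a0; rewrite ger0_norm// -of_real0 of_real_le. Qed.

End ScalarField.

(** * The real-valued norm and its topology *)

Section RealNorm.
Context {R : realType} {s : scalars} {X : normedModType (scalar_field R s)}.
Implicit Types (x y : X) (a e : R).

(** Carries norm inequalities from the scalar field to [R], since [of_real] preserves and reflects
    the order. *)
Lemma of_real_rnorm x : of_real (rnorm x) = `|x|.
Proof. by rewrite to_realK. Qed.

Lemma rnorm_ge0 x : 0 <= rnorm x.
Proof. by rewrite -(@of_real_le R s) of_real0 of_real_rnorm. Qed.

Lemma ler_rnormB x y : rnorm (x - y) <= rnorm x + rnorm y.
Proof. by rewrite -(@of_real_le R s) of_realD !of_real_rnorm ler_normB. Qed.

Lemma rnorm_distC x y : rnorm (x - y) = rnorm (y - x).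
Proof. by rewrite /rnorm distrC. Qed.

Lemma rnormZ a x : 0 <= a -> rnorm (of_real a *: x) = a * rnorm x.
Proof.
move=> a0; apply: (can_inj (@of_realK R s)).
by rewrite of_realM !of_real_rnorm normrZ norm_of_real.
Qed.

Lemma rnorm_eq0 x : rnorm x = 0 -> x = 0.
Proof. by move=> x0; apply/normr0_eq0; rewrite -of_real_rnorm x0 of_real0. Qed.

(** A positive scalar is the image of a positive real, so real radii give the same
    neighbourhoods. *)
Lemma nbhs_rnormP x (A : set X) :
  nbhs x A <-> exists2 e, 0 < e & forall y, rnorm (x - y) < e -> A y.
Proof.
split=> [/nbhs_ballP[e /= e0 eA]|[e e0 eA]].
- have eE := to_realK (ltW e0); exists (to_real e).
    by rewrite -(@of_real_lt R s) eE of_real0.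
  move=> y xy; apply: eA; rewrite -ball_normE/= -of_real_rnorm -eE.
  by rewrite of_real_lt.
- apply/nbhs_ballP; exists (of_real e); first by rewrite /= -of_real0 of_real_lt.
  by move=> y; rewrite -ball_normE/= -of_real_rnorm of_real_lt => /eA.
Qed.

Lemma ler_dist_rnorm x y : `|rnorm x - rnorm y| <= rnorm (x - y).
Proof.
have sub (u v : X) : rnorm u - rnorm v <= rnorm (u - v).
  by rewrite lerBlDr -(@of_real_le R s) of_realD !of_real_rnorm -lerBlDr lerB_dist.
by rewrite ler_norml sub andbT lerNl opprB rnorm_distC sub.
Qed.

Lemma rnorm_continuous : continuous (@rnorm R s X).
Proof.
move=> x; apply/cvgrPdist_lt => e e0; apply/nbhs_rnormP; exists e => // y.
exact/le_lt_trans/ler_dist_rnorm.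
Qed.

End RealNorm.

(** * Baire's theorem over either field, and continuity of powers *)

Lemma Baire_scalar (R : realType) (s : scalars)
    (X : completeNormedModType (scalar_field R s)) (F : (set X)^nat) :
  (forall i, open (F i)) -> (forall i, dense (F i)) -> dense (\bigcap_i F i).
Proof.
apply: (@Baire_pseudometric _ _ _ (fun n => of_real n.+1%:R^-1)) => [n|d d0].
  by rewrite -of_real0 of_real_lt invr_gt0.
have dE := to_realK (ltW d0).
have d'0 : 0 < to_real d by rewrite -(@of_real_lt R s) of_real0 dE.
have [n _ /(_ n (leqnn n)) nd] := near_infty_natSinv_lt (PosNum d'0).
by exists n; rewrite -dE of_real_le ltW.
Qed.

Lemma continuous_norm_powR (R : realType) (p : R) :
  0 < p -> continuous (fun a : R => `|a| `^ p).
Proof.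
(* At 0 differentiability may fail, so continuity is checked directly; elsewhere |a| > 0 and the
   power is differentiable. *)
move=> p0 a; have [->|a0] := eqVneq a 0.
  apply/cvgrPdist_lt => e e0; rewrite normr0 powR0 ?gt_eqF//.
  have ep : 0 < e `^ p^-1 by exact: powR_gt0.
  have : \forall b \near (0 : R), `|b| < e `^ p^-1.
    exact: nbhs0_lt.
  apply: filterS => b be; rewrite sub0r normrN ger0_norm ?powR_ge0//.
  have : `|b| `^ p < (e `^ p^-1) `^ p.
    by apply: gt0_ltr_powR; rewrite ?nnegrE ?powR_ge0.
  by rewrite -powRrM mulVf ?gt_eqF// powRr1// ltW.
apply: (@continuous_comp _ _ _ (fun b : R => `|b|) (fun b => b `^ p)).
  exact: norm_continuous.
apply: differentiable_continuous; apply/derivable1_diffP.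
by apply: derivable_powR; rewrite in_itv/= andbT normr_gt0.
Qed.

(** * Cesaro means of p-th powers along orbits *)

Section CesaroMeans.
Context {R : realType} {s : scalars} {X : normedModType (scalar_field R s)}.
Context (T : {linear X -> X}) (p : R) (p_gt0 : 0 < p).
Implicit Types (x y : X) (a : R) (n : nat).

Lemma iterB n x y : iter n T (x - y) = iter n T x - iter n T y.
Proof. by elim: n => //= n ->; rewrite linearB. Qed.

Lemma iterZ n (c : scalar_field R s) x : iter n T (c *: x) = c *: iter n T x.
Proof. by elim: n => //= n ->; rewrite linearZ. Qed.

(* The factor 2^p covers all p > 0 at once: t |-> t^p is convex only for
   p >= 1 and subadditive only for p <= 1. *)
Lemma cesaro_meanB x y n : cesaro_mean p T (x - y) n <=
  2 `^ p * (cesaro_mean p T x n + cesaro_mean p T y n).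
Proof.
rewrite /cesaro_mean -mulrDr mulrCA ler_wpM2l ?invr_ge0//.
rewrite -big_split/= mulr_sumr ler_sum// => k _; rewrite iterB.
set u := iter k T x; set v := iter k T y.
(* With [w] the one of larger norm among [u] and [v], the triangle inequality gives ||u - v|| <= 2
   ||w||, and ||w||^p is one of the two summands. *)
have le2 w : rnorm (u - v) <= 2 * rnorm w ->
    rnorm (u - v) `^ p <= 2 `^ p * rnorm w `^ p.
  rewrite -powRM// ?rnorm_ge0// => /ge0_ler_powR; apply; rewrite ?nnegrE.
  - exact: ltW.
  - exact: rnorm_ge0.
  - by rewrite mulr_ge0 ?rnorm_ge0.
have := ler_rnormB u v; have := powR_ge0 2 p.
have := powR_ge0 (rnorm u) p; have := powR_ge0 (rnorm v) p.
have [uv|/ltW uv] := leP (rnorm u) (rnorm v) => v0 u0 ? ?.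
- have /le2/le_trans : rnorm (u - v) <= 2 * rnorm v by lra.
  by apply; rewrite ler_wpM2l// lerDr.
- have /le2/le_trans : rnorm (u - v) <= 2 * rnorm u by lra.
  by apply; rewrite ler_wpM2l// lerDl.
Qed.

Lemma cesaro_meanZ a x n : 0 <= a ->
  cesaro_mean p T (of_real a *: x) n = a `^ p * cesaro_mean p T x n.
Proof.
move=> a0; rewrite /cesaro_mean [RHS]mulrCA; congr (_ * _); rewrite mulr_sumr.
by apply: eq_bigr => k _; rewrite iterZ rnormZ// powRM// rnorm_ge0.
Qed.

Lemma sup_cesaro_mean_le x (M : R) : (sup_cesaro_mean p T x <= M%:E)%E <->
  forall N, cesaro_mean p T x N.+1 <= M.
Proof.
split=> [sM N|MN].
- by rewrite -lee_fin; apply: le_trans sM; apply: ereal_sup_ubound; exists N.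
- by apply: ge_ereal_sup => _ [N _ <-]; rewrite lee_fin.
Qed.

Lemma sup_cesaro_mean_pinftyP x : sup_cesaro_mean p T x = +oo%E <->
  ~ exists M, forall N, cesaro_mean p T x N.+1 <= M.
Proof.
split=> [sx [M /sup_cesaro_mean_le]|nM]; first by rewrite sx.
case sx : (sup_cesaro_mean p T x) => [r| |] //; exfalso; apply: nM.
- by exists r; apply/sup_cesaro_mean_le; rewrite sx lexx.
- by exists 0; apply/sup_cesaro_mean_le; rewrite sx leNye.
Qed.

Lemma iter_continuous n : bounded_operator T -> continuous (iter n T).
Proof.
move=> [M TM]; elim: n => [|n IH] x; first exact: cvg_id.
apply: (@continuous_comp _ _ _ (iter n T) T); first exact: IH.
move=> A /nbhs_rnormP[e e0 eA]; apply/nbhs_rnormP.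
(* [M] may be zero or negative; |M| + 1 is a positive Lipschitz constant. *)
have M1 : 0 < `|M| + 1 by rewrite ltr_wpDl.
exists (e / (`|M| + 1)) => [|y]; first exact: divr_gt0.
rewrite ltr_pdivlMr// => xy; apply: eA; rewrite -linearB.
apply: le_lt_trans (TM _) _; apply: le_lt_trans xy; rewrite mulrC.
by rewrite ler_wpM2l ?rnorm_ge0// (le_trans (ler_norm M))// lerDl.
Qed.

Lemma cesaro_mean_continuous n : bounded_operator T ->
  continuous (fun x => cesaro_mean p T x n).
Proof.
move=> hT x; apply: cvgM; first exact: cvg_cst.
apply: (@continuous_big R nat +%R 0 xpredT); first exact: add_continuous.
move=> k _; have -> : (fun y => rnorm (iter k T y) `^ p) =
    (fun b => `|b| `^ p) \o (@rnorm R s X \o iter k T).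
  by apply/funext => y /=; rewrite ger0_norm ?rnorm_ge0.
move=> y; apply: continuous_comp; last exact: continuous_norm_powR.
by apply: continuous_comp; [exact: iter_continuous|exact: rnorm_continuous].
Qed.

(** Its complement is the set where every mean is at most [M]; Baire's theorem is applied to these
    open sets with [M] a natural number. *)
Definition mean_above (M : R) : set X :=
  [set x | exists N, M < cesaro_mean p T x N.+1].

Lemma open_mean_above M : bounded_operator T -> open (mean_above M).
Proof.
move=> hT; have -> : mean_above M =
    \bigcup_N [set x | M < cesaro_mean p T x N.+1].
  by apply/seteqP; split=> [x [N] ?|x [N _] ?]; exists N.
apply: bigcup_open => N _.
apply: (@open_comp _ _ (fun x => cesaro_mean p T x N.+1) [set r | M < r]).
- by move=> x _; exact: cesaro_mean_continuous.
- exact: open_gt.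
Qed.

Lemma bigcap_mean_above : \bigcap_(i : nat) mean_above i%:R =
  [set x | sup_cesaro_mean p T x = +oo%E].
Proof.
apply/seteqP; split=> x /=.
  move=> xi; apply/sup_cesaro_mean_pinftyP => -[M MN].
  have [N] := xi (Num.Def.truncn `|M|).+1 I.
  rewrite ltNge => /negP; apply; apply: le_trans (MN N) _.
  by rewrite (le_trans (ler_norm M))// ltW// truncnS_gt.
move=> /sup_cesaro_mean_pinftyP nM i _; apply: contrapT => nN; apply: nM.
by exists i%:R => N; rewrite leNgt; apply/negP => iN; apply: nN; exists N.
Qed.

Lemma sup_cesaro_meanB_pinfty x y : sup_cesaro_mean p T (x - y) = +oo%E ->
  sup_cesaro_mean p T x = +oo%E \/ sup_cesaro_mean p T y = +oo%E.
Proof.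
move=> /sup_cesaro_mean_pinftyP nM; apply: contrapT => /not_orP.
rewrite !sup_cesaro_mean_pinftyP => -[/contrapT[M1 h1] /contrapT[M2 h2]].
apply: nM; exists (2 `^ p * (M1 + M2)) => N.
by apply: le_trans (cesaro_meanB _ _ _) _; rewrite ler_wpM2l ?powR_ge0// lerD.
Qed.

Lemma sup_cesaro_meanZ_pinfty a x : 0 < a -> sup_cesaro_mean p T x = +oo%E ->
  sup_cesaro_mean p T (of_real a *: x) = +oo%E.
Proof.
move=> a0 /sup_cesaro_mean_pinftyP nM; apply/sup_cesaro_mean_pinftyP => -[M MN].
apply: nM; exists (M / a `^ p) => N; have := MN N.
by rewrite cesaro_meanZ ?(ltW a0)// ler_pdivlMr ?powR_gt0// mulrC.
Qed.

(* If the supremum is infinite at x0, it cannot be finite at both y and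
   y + t x0, whose difference is t x0. *)
Lemma dense_sup_cesaro_mean_pinfty x0 : sup_cesaro_mean p T x0 = +oo%E ->
  dense [set x | sup_cesaro_mean p T x = +oo%E].
Proof.
move=> x0oo D [y Dy] oD.
have /nbhs_rnormP[e e0 eD] : nbhs y D by exact: open_nbhs_nbhs.
(* The added 1 keeps the denominator positive and makes ||t x0|| < e strict. *)
have x01 : 0 < rnorm x0 + 1 by rewrite ltr_wpDl ?rnorm_ge0.
have t0 : 0 < e / (rnorm x0 + 1) by exact: divr_gt0.
set z := of_real (e / (rnorm x0 + 1)) *: x0.
have : sup_cesaro_mean p T (y + z - y) = +oo%E.
  by rewrite addrC addKr; exact: sup_cesaro_meanZ_pinfty.
case/sup_cesaro_meanB_pinfty => ?; last by exists y.
exists (y + z); split=> //; apply: eD.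
rewrite rnorm_distC (addrC y) addrK rnormZ ?(ltW t0)//.
by rewrite mulrAC ltr_pdivrMr// ltr_pM2l// ltrDl.
Qed.

(** For x nonzero, dividing by a = (2/e) ||x|| brings x to norm e/2, inside the ball; homogeneity
    costs the factor a^p, whence the constant [K]. *)
Lemma abs_cesaro_bounded_ball (e M : R) : 0 < e ->
  (forall x, rnorm x < e -> forall N, cesaro_mean p T x N.+1 <= M) ->
  abs_cesaro_bounded p T.
Proof.
move=> e0 eM; pose K := `|M| * (2 / e) `^ p.
have K0 : 0 <= K by rewrite mulr_ge0 ?powR_ge0.
(* [K] may vanish; the added 1 makes the constant positive. *)
exists (K + 1); first by rewrite ltr_wpDl.
move=> x; apply: ge_ereal_sup => _ [[//|N] _ <-]; rewrite lee_fin.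
suff : cesaro_mean p T x N.+1 <= K * rnorm x `^ p.
  by move/le_trans; apply; rewrite ler_wpM2r ?powR_ge0// lerDl.
(* At the origin a = 0 is not invertible; homogeneity with factor 0 shows that the mean is 0. *)
have [x0|x0] := eqVneq (rnorm x) 0.
  rewrite x0 powR0 ?gt_eqF// mulr0 (rnorm_eq0 x0) -(scaler0 _ (of_real 0)).
  by rewrite cesaro_meanZ// powR0 ?gt_eqF// mul0r.
have {}x0 : 0 < rnorm x by rewrite lt0r x0 rnorm_ge0.
set a := 2 / e * rnorm x.
have a0 : 0 < a by rewrite mulr_gt0// divr_gt0.
have -> : K * rnorm x `^ p = `|M| * a `^ p.
  by rewrite /K -mulrA -powRM ?rnorm_ge0// divr_ge0 ?ltW.
have : cesaro_mean p T (of_real a^-1 *: x) N.+1 <= M.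
  apply: eM; rewrite rnormZ ?invr_ge0 ?(ltW a0)// mulrC ltr_pdivrMr//.
  by rewrite mulrA mulrCA divff ?gt_eqF// mulr1 ltr_pMl// ltr1n.
rewrite cesaro_meanZ ?invr_ge0 ?(ltW a0)// -powR_inv1 ?(ltW a0)// -powRrM mulN1r powRN.
rewrite mulrC ler_pdivrMr ?powR_gt0// => /le_trans; apply.
by rewrite ler_wpM2r ?powR_ge0// ler_norm.
Qed.

End CesaroMeans.

(** * Equivalence of the three assertions *)

Theorem proposition5p1 (R : realType) (s : scalars)
    (X : completeNormedModType (scalar_field R s))
    (T : {linear X -> X}) (hT : bounded_operator T) (p : R) (hp : 0 < p) :
  [<-> ~ abs_cesaro_bounded p T;
       exists x : X, sup_cesaro_mean p T x = +oo%E;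
       residual [set x : X | sup_cesaro_mean p T x = +oo%E]].
Proof.
tfae.
- move=> nacb; apply: contrapT => noo; apply: nacb.
  (* Otherwise Baire's theorem would yield a point with infinite supremum; so some [mean_above]
     misses a nonempty open set [D]. *)
  have /existsNP[i /existsNP[D /not_implyP[[x0 Dx0] /not_implyP[oD DF]]]] :
      ~ forall i : nat, dense (mean_above T p i%:R).
    move=> dF; have := Baire_scalar (fun i => open_mean_above hp i%:R hT) dF.
    rewrite bigcap_mean_above => /(_ setT) [||x [_ xoo]].
    + by exists 0.
    + exact: openT.
    + by apply: noo; exists x.
  have below y : D y -> forall N, cesaro_mean p T y N.+1 <= i%:R.
    move=> Dy N; rewrite leNgt; apply/negP => iN.
    by apply: DF; exists y; split=> //; exists N.
  have /nbhs_rnormP[e e0 eD] : nbhs x0 D by exact: open_nbhs_nbhs.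
  (* For [z] near the origin both z + x0 and x0 lie in [D], where the means are at most [i]; their
     difference is [z], whence 2^p (i + i). *)
  apply: (abs_cesaro_bounded_ball hp e0 (M := 2 `^ p * (i%:R + i%:R))) => z ze N.
  have -> : z = (z + x0) - x0 by rewrite addrK.
  apply: le_trans (cesaro_meanB _ hp _ _ _) _; rewrite ler_wpM2l ?powR_ge0//.
  by rewrite lerD//; apply: below => //; apply: eD; rewrite rnorm_distC addrK.
- move=> [x0 x0oo]; exists [set x | sup_cesaro_mean p T x = +oo%E]; split=> //.
  + exists (fun i : nat => mean_above T p i%:R).
      by move=> i; exact: open_mean_above.
    by rewrite bigcap_mean_above.
  + exact: dense_sup_cesaro_mean_pinfty x0oo.
- move=> [G [_ dG Goo]] [C _ CT].
  have [||x [_ /Goo/= xoo]] := dG setT; [by exists 0|exact: openT|].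
  suff : (sup_cesaro_mean p T x <= (C * rnorm x `^ p)%:E)%E by rewrite xoo.
  apply: le_trans (CT x); apply: ge_ereal_sup => _ [N _ <-].
  (* [cesaro_mean] at n has n terms, so the index N corresponds to n = N + 1 >= 1. *)
  by apply: ereal_sup_ubound; exists N.+1.
Qed.
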